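(* Let $k,k'\ge 3$, let $G=(V\cup\{m\},E)$ be a $k$-prn-irreducible comparability graph and $G'=(V'\cup\{m'\},E')$ a $k'$-prn-irreducible comparability graph, with disjoint vertex sets. Then $G\ast G'$ is not prn-irreducible.
   Context: All graphs are finite, simple and connected. A comparability graph is a graph admitting a transitive orientation. Comparability graphs are exactly the graphs represented by a concatenation of permutations of their vertex set (a word represents a graph if distinct vertices are adjacent iff their occurrences in the word alternate, i.e., form $abab\cdots$ or $baba\cdots$); $\mathcal{R}^p(C)$ is the least number of permutations needed. For $k\ge 2$, a comparability graph $C=(W,F)$ is $k$-prn-irreducible if $\mathcal{R}^p(C)=k$ and $\mathcal{R}^p(C[W\setminus\{a\}])=k-1$ for every $a\in W$; $C$ is prn-irreducible if it is $k$-prn-irreducible for some $k\ge 2$. Split recomposition: $G\ast G'$ has vertex set $V\cup V'$ and edges: those of $G[V]$, those of $G'[V']$, and all $\overline{ab}$ with $a\in N_G(m)$, $b\in N_{G'}(m')$. *)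

(* Defs.v *)
From mathcomp Require Import all_boot.

Set Implicit Arguments.
Unset Strict Implicit.
Unset Printing Implicit Defensive.

Section Graphs.
Variable T : finType.
Implicit Types (e t : rel T) (w p : seq T) (k : nat).

Definition simple_graph e : Prop := symmetric e /\ irreflexive e.

Definition connected_graph e : Prop := forall x y : T, connect e x y.

Definition transitive_orientation e t : Prop :=
  [/\ forall x y, e x y = t x y || t y x,
      forall x y, ~~ (t x y && t y x)
    & transitive t].

Definition comparability_graph e : Prop :=
  simple_graph e /\ exists t, transitive_orientation e t.

(* The word a b a b ... of length n. *)
Fixpoint altword (a b : T) (n : nat) : seq T :=
  if n is n'.+1 then a :: altword b a n' else [::].

Definition alternate w (a b : T) : bool :=
  let u := [seq x <- w | x \in pred2 a b] in
  (u == altword a b (size u)) || (u == altword b a (size u)).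

(* As usual for word-representability, every vertex must occur in the word;
   this rules out the empty word for a nonempty graph. *)
Definition represents w e : Prop :=
  (forall a, a \in w) /\ (forall a b, a != b -> e a b = alternate w a b).

Definition permutationally_representable e k : Prop :=
  exists ps : seq (seq T),
    [/\ size ps = k,
        forall p, p \in ps -> perm_eq p (enum T)
      & represents (flatten ps) e].

(* R^p(e) = k, as a relation because R^p is only defined for comparability
   graphs. *)
Definition prn_is e k : Prop :=
  permutationally_representable e k
  /\ forall j, permutationally_representable e j -> k <= j.

End Graphs.

Definition induced (T : finType) (e : rel T) (A : {set T}) :
  rel {x : T | x \in A} := fun x y => e (val x) (val y).
Arguments induced {T} e A.

Definition k_prn_irreducible (T : finType) (e : rel T) (k : nat) : Prop :=
  [/\ 2 <= k,
      comparability_graph e,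
      prn_is e k
    & forall a : T, prn_is (induced e [set~ a]) k.-1].

Definition prn_irreducible (T : finType) (e : rel T) : Prop :=
  exists k, k_prn_irreducible e k.

(* The vertex sets V ∪ {m} and V' ∪ {m'} are [option V] and [option V'], with
   [None] as the marked vertex; the disjoint union V ∪ V' is [V + V']. *)
Definition split_recomposition (V V' : finType)
    (G : rel (option V)) (G' : rel (option V')) : rel (V + V') :=
  fun x y => match x, y with
  | inl a, inl b => G (Some a) (Some b)
  | inr a, inr b => G' (Some a) (Some b)
  | inl a, inr b => G None (Some a) && G' None (Some b)
  | inr b, inl a => G None (Some a) && G' None (Some b)
  end.

(* Main.v *)
Require Import Defs.
From mathcomp Require Import all_boot zify.

(** The number of permutations needed for a comparability graph is the order
    dimension of any of its transitive orientations; in particular it does not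
    depend on the orientation.

    Put N = max(k, k').  In a k-prn-irreducible graph the marker is not adjacent
    to every other vertex, so by connectedness some edge leaves its
    neighbourhood, on both sides.  Such edges force every transitive orientation
    of G * G' to induce (up to reversal) an orientation of G - m in which N(m) is
    a down-set and one of G' - m' in which N(m') is an up-set.  Both orders have
    dimension at most N - 1 and can be glued with a single additional linear
    order, so G * G' needs at most N permutations.  But G and G' are induced
    subgraphs of one-vertex deletions of G * G', so if G * G' were
    irreducible it would need at least N + 1. *)

Set Implicit Arguments.
Unset Strict Implicit.
Unset Printing Implicit Defensive.

(** * Alternation in concatenated permutations *)

Section Words.
Variable T : finType.
Implicit Types (e t : rel T) (p : seq T) (a b : T).

Lemma filter_pred2 p a b : uniq p -> a \in p -> b \in p -> a != b ->
  [seq x <- p | x \in pred2 a b] =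
  if index a p < index b p then [:: a; b] else [:: b; a].
Proof.
move=> up ap bp ab; elim: p up ap bp => //= x p IH /andP[xp up].
have sub c d : x = c -> d != c -> d \in p ->
    [seq y <- p | y \in pred2 c d] = [:: d].
  move=> xc dc dp; rewrite -(filter_pred1_uniq up dp).
  apply: eq_in_filter => y yp /=.
  by rewrite !inE; case: eqP => // yc; move: xp; rewrite xc -yc yp.
rewrite !inE ![_ == x]eq_sym; case: (eqVneq x a) => [xa|xa] /=.
  move=> _; rewrite xa (negPf ab) /= => bp.
  by rewrite (sub _ _ xa _ bp) // eq_sym.
case: (eqVneq x b) => [xb|xb] /=; last by move=> ap bp; rewrite IH.
move=> ap _; rewrite xb -(sub b a xb) //; congr (_ :: _).
by apply: eq_filter => y; rewrite !inE orbC.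
Qed.

Lemma altword_pairs a b (bs : seq bool) : a != b ->
  let w := flatten [seq if c then [:: a; b] else [:: b; a] | c <- bs] in
  (w == altword a b (size w)) = all id bs.
Proof.
move=> ab /=; elim: bs => //= -[] bs IH /=; first by rewrite !eqseq_cons !eqxx IH.
by rewrite eqseq_cons eq_sym (negPf ab).
Qed.

(** Restricted to two letters, each permutation leaves one block [ab] or [ba]. An alternation
    starting with [a] breaks at the first block [ba]. *)
Lemma alternate_flatten (ps : seq (seq T)) a b :
    (forall p, p \in ps -> perm_eq p (enum T)) -> a != b ->
  alternate (flatten ps) a b =
  all (fun p => index a p < index b p) ps ||
  all (fun p => index b p < index a p) ps.
Proof.
move=> pps ab; rewrite /alternate filter_flatten.
have mem p x : p \in ps -> x \in p.
  by move=> /pps/perm_mem->; rewrite mem_enum.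
have -> : [seq [seq x <- p | x \in pred2 a b] | p <- ps] =
  [seq if c then [:: a; b] else [:: b; a]
     | c <- [seq index a p < index b p | p <- ps]].
  rewrite -map_comp; apply/eq_in_map => p pp /=.
  by rewrite filter_pred2 ?mem // (perm_uniq (pps _ pp)) enum_uniq.
rewrite altword_pairs // all_map; congr (_ || _).
have -> : [seq if c then [:: a; b] else [:: b; a]
     | c <- [seq index a p < index b p | p <- ps]] =
  [seq if c then [:: b; a] else [:: a; b]
     | c <- [seq index b p < index a p | p <- ps]].
  rewrite -!map_comp; apply/eq_in_map => p pp /=.
  have : index a p != index b p.
    by apply: contra ab => /eqP /(index_inj a (mem _ _ pp) (mem _ _ pp)) ->.
  by case: ltngtP.
by rewrite altword_pairs 1?eq_sym // all_map.
Qed.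

End Words.

(** * Order dimension and representing permutations *)

Section Realizers.
Variable T : finType.
Implicit Types (e s t : rel T) (S M : {set T}) (k : nat).

(* Linear orders are encoded by rank functions, so that [k] of them realize the
   order [t] on [S] when their intersection is [t]. *)
Definition realizable t S k : Prop :=
  exists r : 'I_k -> T -> nat,
    (forall i, {in S &, injective (r i)}) /\
    {in S &, forall x y, x != y -> t x y = [forall i, r i x < r i y]}.

Lemma realizableS t S M k : M \subset S -> realizable t S k -> realizable t M k.
Proof.
move=> /subsetP MS [r [ri rt]]; exists r; split=> [i x y xM yM|x y xM yM].
  by apply: ri; apply: MS.
by apply: rt; apply: MS.
Qed.

Lemma eq_realizable s t S k : {in S &, s =2 t} ->
  realizable s S k -> realizable t S k.
Proof.
move=> st [r [ri rt]]; exists r; split=> // x y xS yS xy.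
by rewrite -st // rt.
Qed.

Lemma realizable_leq t S k k' : 0 < k -> k <= k' ->
  realizable t S k -> realizable t S k'.
Proof.
case: k => // k _ kk' [r [ri rt]].
(* Surplus indices repeat the last order; an empty family, which relates every pair, would have none
   to repeat. *)
exists (fun i => r (inord (minn i k))); split=> [i|x y xS yS xy]; first exact: ri.
rewrite rt //; apply/forallP/forallP=> h i //.
have ik : i < k' by apply: leq_trans kk'.
have := h (Ordinal ik) => /=; rewrite (minn_idPl _) -1?ltnS //.
by rewrite inord_val.
Qed.

Lemma realizable_converse t S k :
  realizable t S k -> realizable (fun x y => t y x) S k.
Proof.
move=> [r [ri rt]]; pose K i := \max_x r i x.
have rK i x : r i x <= K i by apply: (leq_bigmax x).
(* Subtracting from a bound on the ranks reverses each linear order. *)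
exists (fun i x => K i - r i x); split=> [i x y xS yS h|x y xS yS xy].
  by apply: (ri i) => //; have := rK i x; have := rK i y; lia.
rewrite rt 1?eq_sym //; apply: eq_forallb => i.
by have := rK i x; have := rK i y; lia.
Qed.

(** Serves to encode a lexicographic product of two linear orders as one rank function, the
    coordinates being digits in base [K]. *)
Lemma lt_lex K a b a' b' : b < K -> b' < K ->
  (a * K + b < a' * K + b') = (a < a') || ((a == a') && (b < b')).
Proof. by move=> *; case: (ltngtP a a') => [h|h|->] /=; nia. Qed.

Lemma lex_inj K a b a' b' : b < K -> b' < K ->
  a * K + b = a' * K + b' -> a = a' /\ b = b'.
Proof.
move=> ? ? ?; have aa : a = a' by nia.
by split=> //; nia.
Qed.

(** Points outside [M] do not distinguish its elements, so [t] arises by substituting its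
    restriction to [M] for [p]. Each linear order of the quotient absorbs one of [M] in the place of
    [p]. *)
Lemma realizable_subst t S M p k :
    M \subset S -> p \in M ->
    (forall v x, v \in S -> v \notin M -> x \in M ->
       t v x = t v p /\ t x v = t p v) ->
    realizable t M k -> realizable t (p |: (S :\: M)) k -> realizable t S k.
Proof.
move=> MS pM hom [r [ri rt]] [q [qi qt]].
pose K i := (\max_x r i x).+1; have rK i x : r i x < K i by exact: (leq_bigmax x).
pose f x := if x \in M then p else x.
pose g i x := if x \in M then r i x else 0.
have gK i x : g i x < K i by rewrite /g; case: ifP.
have fS x : x \in S -> f x \in p |: (S :\: M).
  by move=> xS; rewrite /f !inE; case: ifP => [|->]; rewrite ?eqxx // xS orbT.
exists (fun i x => q i (f x) * K i + g i x); split=> [i x y xS yS|x y xS yS xy].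
  case/(lex_inj (gK i x) (gK i y)) => /(qi i _ _ (fS _ xS) (fS _ yS)).
  rewrite /f /g; case: ifP => xM; case: ifP => yM //.
  - by move=> _; apply: ri.
  - by move=> py; rewrite -py pM in yM.
  - by move=> xp; rewrite xp pM in xM.
rewrite (eq_forallb (fun i => lt_lex (q i (f x)) (q i (f y)) (gK i x) (gK i y))).
have [xyM|] := boolP ((x \in M) && (y \in M)).
  case/andP: xyM => xM yM; rewrite rt //; apply: eq_forallb => i.
  by rewrite /f /g xM yM ltnn eqxx.
(* For points not both in [M] the leading digits differ, and homogeneity lets them decide [t]. *)
move=> nM; have fxy : f x != f y.
  move: nM; rewrite /f; case: ifP => xM; case: ifP => yM // _.
    by apply: contraFneq yM => <-.
  by apply: contraFneq xM => ->.
have -> : t x y = t (f x) (f y).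
  move: nM; rewrite /f; case: ifP => xM; case: ifP => yM // _.
    by have [] := hom y x yS (negbT yM) xM.
  by have [] := hom x y xS (negbT xM) yM.
rewrite qt ?fS //; apply: eq_forallb => i.
suff /negPf-> : q i (f x) != q i (f y) by rewrite andFb orbF.
by apply: contra fxy => /eqP/(qi i _ _ (fS _ xS) (fS _ yS))->.
Qed.

(** A linear order realizes itself, [k] times over; the rank counts predecessors. *)
Lemma realizable_total t S k : 0 < k -> transitive t ->
    (forall x y, ~~ (t x y && t y x)) ->
    {in S &, forall x y, x != y -> t x y || t y x} -> realizable t S k.
Proof.
move=> k0 tt ta tot; pose r x := #|[set y in S | t y x]|.
have tirr x : t x x = false by have := ta x x; rewrite andbb => /negPf.
have mono x y : x \in S -> t x y -> r x < r y.
  move=> xS txy; apply/proper_card/properP; split.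
    by apply/subsetP => z; rewrite !inE => /andP[-> /tt]; apply.
  by exists x; rewrite !inE ?xS ?txy ?tirr.
exists (fun _ => r); split=> [_ x y xS yS rxy|x y xS yS xy].
  apply/eqP/negPn/negP => /(tot x y xS yS)/orP[] /mono; rewrite rxy ltnn; auto.
apply/idP/forallP => [txy _|/(_ (Ordinal k0)) rxy]; first exact: mono.
have /orP[//|/(mono _ _ yS)] := tot x y xS yS xy.
by move=> ryx; have := ltn_trans rxy ryx; rewrite ltnn.
Qed.

(** The orientation is precedence in every permutation. An inhabitant of [T] guarantees that some
    permutation exists, which makes precedence asymmetric. *)
Lemma realizable_of_representable e k : simple_graph e ->
    T -> permutationally_representable e k ->
  exists2 t, transitive_orientation e t & realizable t setT k.
Proof.
move=> [esym eirr] x0 [ps [sz pps [mem rep]]].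
have inp p x : p \in ps -> x \in p.
  by move=> /pps/perm_mem->; rewrite mem_enum.
have psn : exists p, p \in ps.
  by have /flattenP[p pp _] := mem x0; exists p.
pose t x y := all (fun p => index x p < index y p) ps.
have tN x y : t x y -> t y x -> False.
  move=> /allP txy /allP tyx; case: psn => p pp.
  by have := ltn_trans (txy _ pp) (tyx _ pp); rewrite ltnn.
exists t; first split.
- move=> x y; have [<-|xy] := eqVneq x y; last by rewrite rep // alternate_flatten.
  by rewrite eirr orbb; symmetry; apply/negP => h; apply: (tN _ _ h h).
- by move=> x y; apply/negP => /andP[]; apply: tN.
- move=> y x z /allP xy /allP yz; apply/allP => p pp.
  exact: ltn_trans (xy _ pp) (yz _ pp).
exists (fun i x => index x (nth [::] ps i)); split.
  by move=> i x y _ _; apply: (index_inj x); apply/inp/mem_nth; rewrite sz.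
move=> x y _ _ xy; apply/(all_nthP [::])/forallP => [h i|h i].
  by apply: h; rewrite sz.
by rewrite sz => ik; apply: (h (Ordinal ik)).
Qed.

(** Sorting the vertices by each rank function gives the permutations; [0 < k] makes every vertex
    occur. *)
Lemma representable_of_realizable e t k : 0 < k ->
    transitive_orientation e t -> realizable t setT k ->
  permutationally_representable e k.
Proof.
move=> k0 [et _ _] [r [ri rt]].
pose p i := sort (relpre (r i) leq) (enum T).
have pe i : perm_eq (p i) (enum T) by rewrite /p perm_sort.
have idx i x y : (index x (p i) < index y (p i)) = (r i x < r i y).
  have memp z : z \in p i by rewrite (perm_mem (pe i)) mem_enum.
  have tot : total (relpre (r i) leq) by move=> u v; apply: leq_total.
  have le u v : index u (p i) <= index v (p i) -> r i u <= r i v.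
    have := @sorted_leq_index _ (relpre (r i) leq).
    move=> /(_ (fun _ _ _ => @leq_trans _ _ _) (fun _ => leqnn _) (p i)).
    by move=> /(_ (sort_sorted tot _) u v); apply.
  rewrite !ltnNge; apply/idP/idP; apply: contra; last exact: le.
  move=> h; rewrite leq_eqVlt; case: ltngtP => //= ?.
  have /(ri i) : r i x = r i y by apply/eqP; rewrite eqn_leq h le // ltnW.
  by rewrite !inE => /(_ isT isT) xy; subst; lia.
exists [seq p i | i <- enum 'I_k]; split.
- by rewrite size_map -cardE card_ord.
- by move=> q /mapP[i _ ->].
have pall q : q \in [seq p i | i <- enum 'I_k] -> perm_eq q (enum T).
  by move=> /mapP[i _ ->].
split=> [x|x y xy].
  apply/flattenP; exists (p (Ordinal k0)); first by rewrite map_f ?mem_enum.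
  by rewrite (perm_mem (pe _)) mem_enum.
rewrite alternate_flatten // et.
have aE u v : u != v ->
    t u v = all (fun q => index u q < index v q) [seq p i | i <- enum 'I_k].
  move=> uv; rewrite all_map rt ?inE //; apply/forallP/allP => [h i _|h i] /=.
    by rewrite idx.
  by have := h i (mem_enum _ _); rewrite /= idx.
by rewrite (aE x y) // (aE y x) 1?eq_sym.
Qed.

End Realizers.

(** * Restriction to induced subgraphs *)

Lemma orientation_preim (T T' : finType) (f : T -> T') (e : rel T) (e' t : rel T') :
    (forall x y, e x y = e' (f x) (f y)) ->
  transitive_orientation e' t -> transitive_orientation e (relpre f t).
Proof.
move=> ef [et ta tt]; split=> [x y|x y|y x z] /=; first by rewrite ef et.
  exact: ta.
exact: tt.
Qed.

Lemma realizable_preim (T T' : finType) (f : T -> T') (t : rel T') k :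
  injective f -> realizable t setT k -> realizable (relpre f t) setT k.
Proof.
move=> fi [r [ri rt]]; exists (fun i x => r i (f x)); split.
  by move=> i x y _ _ /ri fxy; apply/fi/fxy; rewrite inE.
by move=> x y _ _ xy; rewrite /= rt ?inE // (inj_eq fi).
Qed.

Lemma representable_preim (T T' : finType) (f : T -> T') (e : rel T) (e' : rel T') k :
    injective f -> (forall x y, e x y = e' (f x) (f y)) -> T -> 0 < k ->
    simple_graph e' -> permutationally_representable e' k ->
  permutationally_representable e k.
Proof.
move=> fi ef x0 k0 e's /(realizable_of_representable e's (f x0))[t et tk].
apply: (@representable_of_realizable _ _ (relpre f t)) => //.
  exact: orientation_preim et.
exact: realizable_preim.
Qed.

(** * Colourings without rainbow triangles *)

Section GallaiColouring.
Variables (T : finType) (C : finType) (col : T -> T -> C).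
Hypothesis col_sym : forall x y, col x y = col y x.
Hypothesis no_rainbow : forall x y z, x != y -> y != z -> x != z ->
  [\/ col x y = col y z, col y z = col x z | col x y = col x z].

Definition colour_rel (S : {set T}) c : rel T :=
  fun x y => [&& x \in S, y \in S & col x y == c].

Lemma colour_rel_sym S c : symmetric (colour_rel S c).
Proof. by move=> x y; rewrite /colour_rel col_sym andbCA. Qed.

Lemma colour_connect_in S c x y :
  connect (colour_rel S c) x y -> x \in S -> y \in S.
Proof.
move=> xy xS; rewrite -(closed_connect _ xy) //.
by move=> u v /and3P[-> ->].
Qed.

(** Along an edge [zw] of colour [c] in the component, neither [zv] nor [wv] has colour [c]; as the
    triangle is not rainbow, these two colours agree. *)
Lemma colour_component (S : {set T}) c x x' v : v \in S -> x \in S ->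
    connect (colour_rel S c) x x' -> ~~ connect (colour_rel S c) x v ->
  col x' v = col x v.
Proof.
move=> vS xS xx' xv.
pose a := [pred z | connect (colour_rel S c) x z && (col z v == col x v)].
suff ca : closed (colour_rel S c) a.
  by have := closed_connect ca xx'; rewrite !inE connect0 eqxx => /esym/andP[_ /eqP].
apply: intro_closed; first exact/sym_connect_sym/colour_rel_sym.
move=> z w zw; rewrite !inE => /andP[xz /eqP <-].
have xw := connect_trans xz (connect1 zw); rewrite xw /=.
have nc u : connect (colour_rel S c) x u -> col u v != c.
  move=> xu; apply: contra xv => uv; apply: connect_trans (xu) (connect1 _).
  by rewrite /colour_rel vS uv (colour_connect_in xu).
have nv u : connect (colour_rel S c) x u -> u != v.
  by move=> xu; apply: contraNneq xv => <-.
have [->//|zNw] := eqVneq z w.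
have /and3P[_ _ /eqP zwc] := zw.
case: (no_rainbow zNw (nv _ xw) (nv _ xz)) => h.
- by have := nc _ xw; rewrite -h zwc eqxx.
- exact/eqP.
- by have := nc _ xz; rewrite -h zwc eqxx.
Qed.

Hypothesis three_colours :
  forall c : C, exists c1 c2 : C, [/\ c1 != c, c2 != c & c1 != c2].

(** This is Gallai's theorem, by induction removing a vertex [v]: were every colour connected on
    [S], a colour disconnected on the rest would force contradictory colours between its
    components. *)
Lemma colour_disconnected (S : {set T}) : 1 < #|S| ->
  exists c x y, [/\ x \in S, y \in S & ~~ connect (colour_rel S c) x y].
Proof.
have [n] := ubnP #|S|; elim: n S => // n IH S; rewrite ltnS => Sn S1.
have [v vS] : exists v, v \in S by apply/card_gt0P/ltnW.
pose U := S :\ v.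
have cU : #|S| = #|U|.+1 by rewrite (cardsD1 v) vS.
have vU : v \notin U by rewrite !inE eqxx.
have US x : x \in U -> x \in S by rewrite inE => /andP[].
have Sv x : x \in S -> x != v -> x \in U by rewrite !inE => -> ->.
have Uv x : x \in U -> x != v by rewrite !inE => /andP[].
have [/existsP[c /exists_inP[x xS /exists_inP[y yS xy]]]|] := boolP
  [exists c, [exists x in S, [exists y in S, ~~ connect (colour_rel S c) x y]]].
  by exists c, x, y.
rewrite negb_exists => /forallP con0.
have {con0} con c x y : x \in S -> y \in S -> connect (colour_rel S c) x y.
  move=> xS yS; have := con0 c; rewrite negb_exists_in => /forall_inP/(_ x xS).
  by rewrite negb_exists_in => /forall_inP/(_ y yS); rewrite negbK.
exfalso.
have [u uU] : exists u, u \in U by apply/card_gt0P; lia.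
(* The first step away from [v] on a path of colour [c] is such a [y]. *)
have vc c : exists2 y, y \in U & col v y = c.
  have /connectP[p] := con c v u vS (US _ uU).
  have uv := Uv _ uU.
  elim: p => [_ uv'|y p IHp]; first by rewrite uv' eqxx in uv.
  move=> /= /andP[/and3P[_ yS /eqP vy] yp] ulast.
  have [yv|yv] := eqVneq y v; first by apply: IHp; rewrite -?yv.
  by exists y => //; apply: Sv.
have [U1|U1] := leqP #|U| 1.
  have [c [_ [cu _ _]]] := three_colours (col v u).
  have [y yU vy] := vc c.
  suff yu : y = u by rewrite -vy yu eqxx in cu.
  by apply: (card_le1_eqP U1).
have [|c [x0 [y0 [x0U y0U x0y0]]]] := IH U _ U1; first by lia.
have csym := sym_connect_sym (colour_rel_sym U c).
(* A component in [U] with no edge of colour [c] to [v] would stay a component in [S]. *)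
have reach x : x \in U -> exists2 x', connect (colour_rel U c) x x' & col v x' = c.
  move=> xU; have [/exists_inP[x' xx' /eqP vx']|] := boolP
    [exists x' in connect (colour_rel U c) x, col v x' == c]; first by exists x'.
  rewrite negb_exists_in => /forall_inP nc.
  have cl : closed (colour_rel S c) (connect (colour_rel U c) x).
    apply: intro_closed; first exact/sym_connect_sym/colour_rel_sym.
    move=> z w /and3P[_ wS zw] xz; apply: connect_trans (xz) (connect1 _).
    have zU := colour_connect_in xz xU.
    rewrite /colour_rel zU zw andbT Sv //; apply: contraTneq zw => ->.
    by rewrite col_sym nc.
  have := closed_connect cl (con c x v (US _ xU) vS).
  rewrite [x \in _]connect0 => /esym xv.
  by have := colour_connect_in xv xU; rewrite (negPf vU).
(* In the triangle [v], [y], [w'] the edges at [v] have colours [c1] and [c], and [yw'] is not [c],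
   so it is [c1]; this passes to [w] along its component. *)
have far c1 y w : c1 != c -> y \in U -> w \in U -> col v y = c1 ->
    ~~ connect (colour_rel U c) y w -> col y w = c1.
  move=> c1c yU wU vy yw; have [w' ww' vw'] := reach w wU.
  have w'U := colour_connect_in ww' wU.
  have yw' : ~~ connect (colour_rel U c) y w'.
    by apply: contra yw => /connect_trans; apply; rewrite csym.
  have wNy : ~~ connect (colour_rel U c) w y by rewrite csym.
  rewrite col_sym -(colour_component yU wU ww' wNy) col_sym.
  have yw'c : col y w' != c.
    by apply: contra yw' => h; apply: connect1; rewrite /colour_rel yU w'U.
  have ynw' : y != w' by apply: contraNneq yw' => ->; apply: connect0.
  have vy' : v != y by rewrite eq_sym Uv.
  have vw'' : v != w' by rewrite eq_sym Uv.
  case: (no_rainbow vy' ynw' vw''); rewrite ?vy ?vw' => h.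
  - by [].
  - by rewrite h eqxx in yw'c.
  - by rewrite h eqxx in c1c.
have [c1 [c2 [c1c c2c c12]]] := three_colours c.
have [y yU vy] := vc c1; have [z zU vz] := vc c2.
(* In different components, [yz] would have both colours [c1] and [c2]. In the same one, an outside
   [w] would see it in two colours. *)
have [yz|yz] := boolP (connect (colour_rel U c) y z); last first.
  have zy : ~~ connect (colour_rel U c) z y by rewrite csym.
  move: c12; rewrite -(far _ _ _ c1c yU zU vy yz) col_sym.
  by rewrite (far _ _ _ c2c zU yU vz zy) eqxx.
have [w wU yw] : exists2 w, w \in U & ~~ connect (colour_rel U c) y w.
  have [yx0|] := boolP (connect (colour_rel U c) y x0); last by exists x0.
  exists y0 => //; apply: contra x0y0; apply: connect_trans.
  by rewrite csym.
have zw : ~~ connect (colour_rel U c) z w.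
  by apply: contra yw; apply: connect_trans.
move: c12; rewrite -(far _ _ _ c1c yU wU vy yw) -(far _ _ _ c2c zU wU vz zw).
by rewrite (colour_component wU yU yz yw) eqxx.
Qed.

End GallaiColouring.

(** * Comparability invariance of dimension *)

Section Invariance.
Variables (T : finType) (e : rel T).
Implicit Types (s t : rel T).

Lemma orientation_sym t : transitive_orientation e t -> symmetric e.
Proof. by case=> et _ _ x y; rewrite !et orbC. Qed.

Lemma orientation_flip t x y : transitive_orientation e t -> e x y -> t y x = ~~ t x y.
Proof. by case=> -> /(_ x y) + _; case: (t x y); case: (t y x). Qed.

Lemma orientation_adj t x y : transitive_orientation e t -> ~~ e x y -> t x y = false.
Proof. by case=> -> _ _; case: (t x y). Qed.

(* [None], nonadjacency, is the third colour of a Gallai colouring. *)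
Definition agreement s t x y : option bool :=
  if e x y then Some (s x y == t x y) else None.

Lemma agreement_sym s t : transitive_orientation e s -> transitive_orientation e t ->
  forall x y, agreement s t x y = agreement s t y x.
Proof.
move=> os ot x y; rewrite /agreement (orientation_sym os y x).
case: ifP => // exy; rewrite (orientation_flip os exy) (orientation_flip ot exy).
by case: (s x y); case: (t x y).
Qed.

(** Opposite directions at [y] would give a directed path through [y], and transitivity would make
    [x] and [z] adjacent. *)
Lemma orientation_nonadj t y x z : transitive_orientation e t ->
  e y x -> e y z -> ~~ e x z -> t y x = t y z.
Proof.
move=> ot yx yz xz; have [et _ tt] := ot.
have xy := orientation_flip ot yx; have zy := orientation_flip ot yz.
case yxE: (t y x); case yzE: (t y z) => //; move: xz; rewrite et.
  by rewrite (tt y z x) ?orbT // zy yzE.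
by rewrite (tt y x z) // xy yxE.
Qed.

Lemma agreement_nonadj s t y x z :
    transitive_orientation e s -> transitive_orientation e t ->
  e y x -> e y z -> ~~ e x z -> agreement s t y x = agreement s t y z.
Proof.
move=> os ot yx yz xz; rewrite /agreement yx yz.
by rewrite (orientation_nonadj os yx yz xz) (orientation_nonadj ot yx yz xz).
Qed.

(** Three edges share two colours, two nonadjacent pairs share [None], and a single nonadjacent pair
    forces the other two edges to agree. *)
Lemma agreement_no_rainbow s t x y z :
    transitive_orientation e s -> transitive_orientation e t ->
  [\/ agreement s t x y = agreement s t y z,
      agreement s t y z = agreement s t x z
    | agreement s t x y = agreement s t x z].
Proof.
move=> os ot; have agC := agreement_sym os ot; have esym := orientation_sym os.
have [xy|xy] := boolP (e x y); have [yz|yz] := boolP (e y z);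
  have [xz|xz] := boolP (e x z).
- rewrite /agreement xy yz xz.
  case: (_ == _); case: (_ == _); case: (_ == _);
    by [apply: Or31 | apply: Or32 | apply: Or33].
- by apply: Or31; rewrite agC; apply: agreement_nonadj; rewrite // esym.
- by apply: Or33; apply: agreement_nonadj.
- by apply: Or32; rewrite /agreement (negPf yz) (negPf xz).
- by apply: Or32; rewrite agC [RHS]agC; apply: agreement_nonadj; rewrite // esym.
- by apply: Or33; rewrite /agreement (negPf xy) (negPf xz).
- by apply: Or31; rewrite /agreement (negPf yz) (negPf xy).
- by apply: Or31; rewrite /agreement (negPf yz) (negPf xy).
Qed.

(** Otherwise [v] is the middle of a [t]-chain on [x] and [x'], and of an [s]-chain running the same
    or the opposite way; transitivity then gives [xx'] the colour of [vx]. *)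
Lemma agreement_homogeneous s t v x x' :
    transitive_orientation e s -> transitive_orientation e t ->
    agreement s t v x = agreement s t v x' ->
    agreement s t x x' != agreement s t v x ->
  t v x = t v x'.
Proof.
move=> os ot; have esym := orientation_sym os; rewrite /agreement.
have [vx|vx] := boolP (e v x); have [vx'|vx'] := boolP (e v x') => //=; last first.
  by rewrite (orientation_adj ot vx) (orientation_adj ot vx').
have [xx'|xx' _ _] := boolP (e x x'); last exact: orientation_nonadj xx'.
have [_ _ st] := os; have [_ _ tt] := ot.
move=> -[agr]; rewrite (inj_eq Some_inj) => dis.
have := (st v x x', st v x' x, tt v x x', tt v x' x); move: agr dis.
rewrite (orientation_flip os xx') (orientation_flip os vx) (orientation_flip os vx').
rewrite (orientation_flip ot xx') (orientation_flip ot vx) (orientation_flip ot vx').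
case: (s v x); case: (s v x'); case: (t v x); case: (t v x');
  case: (s x x'); case: (t x x') => //= _ _ [[[h1 h2] h3] h4];
  by [move: (h1 isT isT) | move: (h2 isT isT) | move: (h3 isT isT)
    | move: (h4 isT isT)].
Qed.

(* Some colour of [agreement] is disconnected on [S]; a component of it is a
   homogeneous set for [t], and [t] is a substitution along it. If that colour
   is absent, [t] is [s], its converse, or linear on [S]. *)
Lemma realizable_invariant s t S k : 0 < k ->
    transitive_orientation e s -> transitive_orientation e t ->
  realizable s S k -> realizable t S k.
Proof.
move=> k0 os ot; have [n] := ubnP #|S|; elim: n S => // n IH S; rewrite ltnS => Sn rs.
have [S1|S1] := leqP #|S| 1.
  have [r [ri _]] := rs; exists r; split=> // x y xS yS /eqP[].
  exact: (card_le1_eqP S1).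
pose col := agreement s t.
have colC x y : col x y = col y x := agreement_sym os ot x y.
have rainbow x y z : x != y -> y != z -> x != z ->
    [\/ col x y = col y z, col y z = col x z | col x y = col x z].
  by move=> _ _ _; apply: agreement_no_rainbow.
have three (c : option bool) : exists c1 c2, [/\ c1 != c, c2 != c & c1 != c2].
  by case: c => [[]|]; [exists None, (Some false)|exists None, (Some true)|
    exists (Some true), (Some false)].
have [c [x0 [y0 [x0S y0S x0y0]]]] := colour_disconnected colC rainbow three S1.
have [/exists_inP[x xS /exists_inP[y yS /andP[xy cxy]]]|none] :=
  boolP [exists x in S, [exists y in S, (x != y) && (col x y == c)]].
  (* [M] contains [y] besides [x], so contracting it loses a point; disconnectedness makes [M]
     proper. Induction thus applies to both pieces. *)
  pose M := [set z | connect (colour_rel col S c) x z].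
  have xM : x \in M by rewrite inE connect0.
  have yM : y \in M by rewrite inE connect1 // /colour_rel xS yS.
  have MS : M \subset S.
    by apply/subsetP => z; rewrite inE => /colour_connect_in; apply.
  have csym := sym_connect_sym (colour_rel_sym colC S c).
  have [w wS wM] : exists2 w, w \in S & w \notin M.
    have [x0M|] := boolP (x0 \in M); last by exists x0.
    exists y0 => //; apply: contra x0y0; move: x0M; rewrite !inE => xx0 xy0.
    exact: connect_trans (etrans (csym _ _) xx0) xy0.
  have Mx : (#|x |: S :\: M| < #|S|)%N.
    have : x |: S :\: M \subset S :\ y.
      apply/subsetP => z; rewrite !inE => /orP[/eqP->|/andP[zM zS]]; first by rewrite xy.
      by rewrite zS andbT; apply: contraNneq zM => ->; move: yM; rewrite inE.
    by move=> /subset_leq_card; rewrite (cardsD1 y S) yS; lia.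
  have MltS : (#|M| < #|S|)%N.
    by apply/proper_card/properP; split=> //; exists w.
  apply: (realizable_subst MS xM).
  - move=> v z vS vM zM; rewrite inE in vM.
    have xz : connect (colour_rel col S c) x z by rewrite inE in zM.
    have vN u : connect (colour_rel col S c) x u -> col u v != c.
      move=> xu; apply: contra vM => uv; apply: connect_trans (xu) (connect1 _).
      by rewrite /colour_rel vS uv (colour_connect_in xu).
    have colv u : connect (colour_rel col S c) x u -> col v u = col v x.
      by move=> xu; rewrite colC [RHS]colC; apply: colour_component xu vM.
    (* The colour from [v] to the component is constant and differs from [c], so [t v] is constant
       along each edge of colour [c]. *)
    have tv : t v z = t v x.
      pose a := [pred u | connect (colour_rel col S c) x u && (t v u == t v x)].
      have ca : closed (colour_rel col S c) a.
        apply: intro_closed => // u u' uu'; rewrite !inE => /andP[xu /eqP <-].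
        have xu' := connect_trans xu (connect1 uu'); rewrite xu' /=.
        apply/eqP/esym/(agreement_homogeneous os ot).
          by rewrite -/col !colv.
        have /and3P[_ _ /eqP uu'c] := uu'.
        by rewrite -/col uu'c eq_sym colC vN.
      have := closed_connect ca xz; rewrite !inE connect0 eqxx.
      by move=> /esym/andP[_ /eqP].
    split=> //; have := colv z xz; rewrite /col /agreement.
    have [vz|vz] := boolP (e v z); have [vx|vx] := boolP (e v x) => // _.
      by rewrite (orientation_flip ot vz) (orientation_flip ot vx) tv.
    by rewrite !(orientation_adj ot) // -(orientation_sym ot).
  - by apply: IH; [lia | apply: realizableS rs].
  - apply: IH; [lia | apply: realizableS rs].
    by rewrite subUset sub1set xS subsetDl.
have nocol u v : u \in S -> v \in S -> u != v -> col u v != c.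
  move=> uS vS uv; move: none; rewrite negb_exists_in => /forall_inP/(_ u uS).
  by rewrite negb_exists_in => /forall_inP/(_ v vS); rewrite uv.
have [et ta tt] := ot; have [es sa st] := os.
have irr r u : transitive_orientation e r -> r u u = false.
  by case=> _ /(_ u u) + _; rewrite andbb => /negPf.
(* Without [Some true] the orders disagree on every edge, without [Some false] they agree on every
   edge, and without [None] all pairs are adjacent. *)
case: c nocol {x0y0 none} => [b|] nocol.
  have [b1|b1] : b \/ ~~ b by case: b {nocol}; auto.
    apply: (eq_realizable _ (realizable_converse rs)) => u v uS vS.
    have [<-|uv] := eqVneq u v; first by rewrite !irr.
    have := nocol u v uS vS uv; rewrite /col /agreement b1.
    have [euv|euv _] := boolP (e u v); last first.
      by rewrite !(orientation_adj os, orientation_adj ot) // -(orientation_sym os).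
    rewrite (inj_eq Some_inj); have := orientation_flip os euv.
    by case: (s v u); case: (s u v); case: (t u v).
  apply: (eq_realizable _ rs) => u v uS vS.
  have [<-|uv] := eqVneq u v; first by rewrite !irr.
  have := nocol u v uS vS uv; rewrite /col /agreement (negPf b1).
  have [_|euv _] := boolP (e u v).
    by rewrite (inj_eq Some_inj); case: (s u v); case: (t u v).
  by rewrite !(orientation_adj os, orientation_adj ot).
apply: realizable_total => // u v uS vS uv.
by have := nocol u v uS vS uv; rewrite /col /agreement -et; case: (e u v).
Qed.

End Invariance.

Lemma orientation_converse (T : finType) (e t : rel T) :
  transitive_orientation e t -> transitive_orientation e (fun x y => t y x).
Proof.
case=> et ta tt; split=> [x y|x y|y x z xy yz]; first by rewrite et orbC.
  exact: ta.
exact: tt yz xy.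
Qed.

(** * Gluing two orders along a down-set and an up-set *)

Section Gluing.
Variables (V V' : finType) (s : rel V) (s' : rel V') (A : pred V) (B : pred V').

Definition glue : rel (V + V') := fun x y =>
  match x, y with
  | inl a, inl b => s a b
  | inr a, inr b => s' a b
  | inl a, inr b => A a && B b
  | inr _, inl _ => false
  end.

Hypothesis A_down : forall x a, s x a -> A a -> A x.
Hypothesis B_up : forall b y, s' b y -> B b -> B y.

Lemma glue_trans : transitive s -> transitive s' -> transitive glue.
Proof.
move=> st st' [y|y] [x|x] [z|z] //=; first exact: st.
- by move=> /A_down h /andP[/h-> ->].
- by move=> /andP[-> Bx] /B_up->.
- exact: st'.
Qed.

(* In each of the first [n] linear orders all of [V] lies below [V']; one more
   linear order, V' \ B < A < B < V \ A, reverses every incomparable pair. *)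
Lemma glue_realizable n : 0 < n ->
    realizable s setT n -> realizable s' setT n -> realizable glue setT n.+1.
Proof.
case: n => // n _ [r [ri rs]] [r' [ri' rs']].
pose K := (\max_(i < n.+1) \max_x r i x + \max_(i < n.+1) \max_x r' i x).+1.
have rK i x : r i x < K.
  rewrite ltnS; apply: leq_trans (leq_addr _ _).
  exact: leq_trans (leq_bigmax x) (leq_bigmax i).
have rK' i x : r' i x < K.
  rewrite ltnS; apply: leq_trans (leq_addl _ _).
  exact: leq_trans (leq_bigmax x) (leq_bigmax i).
(* Index [ord0] is the additional order. As [K] exceeds every rank, the offsets 0, [K], [2 * K],
   [3 * K] separate its four blocks. *)
pose q (i : 'I_n.+2) (z : V + V') :=
  match unlift ord0 i, z with
  | Some j, inl x => r j x
  | Some j, inr y => K + r' j y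
  | None, inl x => (if A x then K else 3 * K) + r ord0 x
  | None, inr y => (if B y then 2 * K else 0) + r' ord0 y
  end.
have qE z w : [forall i, q i z < q i w] =
    (q ord0 z < q ord0 w) && [forall j, q (lift ord0 j) z < q (lift ord0 j) w].
  apply/forallP/andP => [h|[h0 /forallP h] i].
    by split; [apply: h | apply/forallP => j; apply: h].
  by case: (unliftP ord0 i) => [j|] ->.
exists q; split=> [i z w _ _|z w _ _ zw].
  rewrite /q; case: unliftP => [j _|_]; case: z => [x|x]; case: w => [y|y].
  - by move=> /ri->; rewrite ?inE.
  - by have := rK j x; lia.
  - by have := rK j y; lia.
  - by move=> /addnI/ri'->; rewrite ?inE.
  - have := rK ord0 x; have := rK ord0 y.
    case: (A x); case: (A y) => ? ? h; congr inl; apply: (ri ord0);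
      by rewrite ?inE //; lia.
  - have := rK ord0 x; have := rK' ord0 y.
    by case: (A x); case: (B y) => ? ? h; lia.
  - have := rK' ord0 x; have := rK ord0 y.
    by case: (B x); case: (A y) => ? ? h; lia.
  - have := rK' ord0 x; have := rK' ord0 y.
    case: (B x); case: (B y) => ? ? h; congr inr; apply: (ri' ord0);
      by rewrite ?inE //; lia.
rewrite qE /q unlift_none; under eq_forallb => j do rewrite liftK.
case: z w zw => [x|x] [y|y] /= zw.
- have xy : x != y by apply: contra zw => /eqP->.
  (* The additional order respects [s] because [A] is a down-set, so no comparability is lost. *)
  rewrite rs ?inE //; symmetry; apply/andb_idl => /forallP h.
  have sxy : s x y by rewrite rs ?inE //; apply/forallP.
  have := h ord0; have := rK ord0 x; have := A_down sxy.
  by case: (A y) => [/(_ isT)->|_]; last case: (A x); lia.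
- apply/andP/andP => [[-> ->]|[]].
    split; first by have := rK ord0 x; lia.
    by apply/forallP => j; have := rK j x; lia.
  by have := rK' ord0 y; case: (A x); case: (B y) => //; lia.
- symmetry; apply/negP => /andP[_ /forallP/(_ ord0)].
  by have := rK ord0 y; lia.
- have xy : x != y by apply: contra zw => /eqP->.
  rewrite rs' ?inE //; under [in RHS]eq_forallb => j do rewrite ltn_add2l.
  symmetry; apply/andb_idl => /forallP h.
  have sxy : s' x y by rewrite rs' ?inE //; apply/forallP.
  have := h ord0; have := rK' ord0 x; have := B_up sxy.
  by case: (B x) => [/(_ isT)->|_]; last case: (B y); lia.
Qed.

End Gluing.

(** * Irreducible graphs with a marked vertex *)

Lemma induced_simple (T : finType) (e : rel T) (A : {set T}) :
  simple_graph e -> simple_graph (induced e A).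
Proof. by case=> es ei; split=> [x y|x]; [apply: es | apply: ei]. Qed.

Section Marked.
Variables (V : finType) (G : rel (option V)).

Definition unmarked : rel V := relpre Some G.

Lemma unmarked_representable k : V -> 0 < k -> simple_graph G ->
    permutationally_representable (induced G [set~ None]) k ->
  permutationally_representable unmarked k.
Proof.
move=> a0 k0 Gs.
have nN (a : V) : Some a \in [set~ None] by rewrite !inE.
apply: (@representable_preim _ _ (fun a => exist _ (Some a) (nN a))) => //.
  by move=> a b [].
exact: induced_simple.
Qed.

(** Were the marker the only vertex, its deletion would leave the empty graph, represented by no
    permutation, whereas [k.-1] is positive. *)
Lemma marked_vertex_inhabited k : k_prn_irreducible G k -> inhabited V.
Proof.
case=> k2 _ _ /(_ None)[_ kmin].
have [a _|V0] := pickP (predT : pred V); first exact: inhabits.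
have T0 (z : {x | x \in [set~ None : option V]}) : False.
  by case: z => [[a|]]; [have := V0 a | rewrite !inE].
suff /kmin : permutationally_representable (induced G [set~ None]) 0.
  by case: k k2 {kmin} => [|[]].
exists [::]; split=> //; split=> [z|z]; by case: (T0 z).
Qed.

(* A vertex adjacent to all others can be added at the front of every
   permutation. *)
Lemma irreducible_not_universal k :
  k_prn_irreducible G k -> exists d, ~~ G None (Some d).
Proof.
move=> irr; have [a0] := marked_vertex_inhabited irr.
have [k2 [Gs _] [_ kmin] /(_ None)[rep _]] := irr.
apply/existsP; rewrite -negb_forall; apply/negP => /forallP univ.
have [Gsym Girr] := Gs.
have k0 : 0 < k.-1 by lia.
have us : simple_graph unmarked.
  by split=> [x y|x]; [apply: Gsym | apply: Girr].
have [t [et ta tt] [r [ri rt]]] :=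
  realizable_of_representable us a0 (unmarked_representable a0 k0 Gs rep).
pose t' : rel (option V) := fun x y =>
  match x, y with
  | Some a, Some b => t a b
  | None, Some _ => true
  | _, None => false
  end.
suff /kmin : permutationally_representable G k.-1 by lia.
apply: (@representable_of_realizable _ _ t') => //.
  split=> [[x|] [y|]|[x|] [y|]|[y|] [x|] [z|]] //=.
  - exact: et.
  - by rewrite Gsym univ.
  - exact: univ.
  - exact: tt.
exists (fun i x => if x is Some a then (r i a).+1 else 0); split.
  by move=> i [x|] [y|] _ _ //= [/ri->]; rewrite ?inE.
move=> [x|] [y|] _ _ //= xy; last 2 first.
- by symmetry; apply/negP => /forallP/(_ (Ordinal k0)).
- by symmetry; apply/forallP.
by rewrite rt ?inE.
Qed.

(** Without such an edge the marker and its neighbours would form a closed set missing [d]. *)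
Lemma connected_marked_edge d : connected_graph G -> symmetric G ->
    ~~ G None (Some d) ->
  exists a c, [/\ G None (Some a), ~~ G None (Some c) & G (Some a) (Some c)].
Proof.
move=> Gc Gs nd.
have [/existsP[a /existsP[c /and3P[]]]|none] := boolP
  [exists a, [exists c,
     [&& G None (Some a), ~~ G None (Some c) & G (Some a) (Some c)]]].
  by exists a, c.
pose P := [pred x : option V | if x is Some a then G None (Some a) else true].
have cl : closed G P.
  apply: intro_closed; first exact: sym_connect_sym.
  move=> [a|] [c|] //= ac Pa; move: none; rewrite negb_exists => /forallP/(_ a).
  by rewrite negb_exists => /forallP/(_ c); rewrite [G None _]Pa ac andbT negbK.
by have := closed_connect cl (Gc None (Some d)); rewrite !inE (negPf nd).
Qed.

End Marked.

(** * Orientations and vertex deletions of the split recomposition *)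

Section Recomposition.
Variables (V V' : finType) (G : rel (option V)) (G' : rel (option V')).
Let C := split_recomposition G G'.

Lemma glue_orientation (s : rel V) (s' : rel V') :
    transitive_orientation (unmarked G) s ->
    transitive_orientation (unmarked G') s' ->
    (forall x a, s x a -> G None (Some a) -> G None (Some x)) ->
    (forall b y, s' b y -> G' None (Some b) -> G' None (Some y)) ->
  transitive_orientation C
    (glue s s' (fun a => G None (Some a)) (fun b => G' None (Some b))).
Proof.
move=> [es sa st] [es' sa' st'] down up; split; last exact: glue_trans.
  by move=> [x|x] [y|y] /=; rewrite ?orbF //; [apply: es | apply: es'].
by move=> [x|x] [y|y] //=; rewrite andbF.
Qed.

(* [b0 c] and [a0 d] are edges leaving the neighbourhoods of the markers. They
   force any orientation of [C] to place the two neighbourhoods on either side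
   of [b0] and of [a0]. *)
Lemma recomposition_orientation a0 d b0 c :
    G None (Some a0) -> ~~ G None (Some d) -> G (Some a0) (Some d) ->
    G' None (Some b0) -> ~~ G' None (Some c) -> G' (Some b0) (Some c) ->
    (exists s, transitive_orientation C s) ->
  exists s s', [/\ transitive_orientation (unmarked G) s,
      transitive_orientation (unmarked G') s',
      forall x a, s x a -> G None (Some a) -> G None (Some x)
    & forall b y, s' b y -> G' None (Some b) -> G' None (Some y)].
Proof.
move=> Aa0 Ad a0d Bb0 Bc b0c [s0 os0].
have [s os sb0c] : exists2 s, transitive_orientation C s & ~~ s (inr b0) (inr c).
  have [h|] := boolP (s0 (inr b0) (inr c)); last by exists s0.
  exists (fun x y => s0 y x); first exact: orientation_converse.
  by rewrite (orientation_flip os0) ?h.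
have [es sa st] := os.
have Ab0 a : G None (Some a) -> s (inl a) (inr b0).
  move=> Aa; have eab : C (inr b0) (inl a) by rewrite /= Aa.
  rewrite (orientation_flip os eab) (@orientation_nonadj _ _ _ _ _ (inr c) os) //.
  by rewrite /= (negPf Bc) andbF.
have sa0 b : G' None (Some b) -> s (inl a0) (inr b) = s (inl a0) (inl d).
  by move=> Bb; apply: (orientation_nonadj os); rewrite /= ?Aa0 ?(negPf Ad).
have a0B b : G' None (Some b) -> s (inl a0) (inr b).
  by move=> Bb; rewrite sa0 // -(sa0 b0) // Ab0.
exists (relpre inl s), (relpre inr s); split=> [||x a xa Aa|b y bry Bb].
- exact: orientation_preim os.
- exact: orientation_preim os.
(* Transitivity puts [x] below [b0], hence adjacent to it, which only neighbours of the marker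
   are. *)
- have : C (inl x) (inr b0) by rewrite es (st _ _ _ xa (Ab0 a Aa)).
  by case/andP.
- have : C (inl a0) (inr y) by rewrite es (st _ _ _ (a0B b Bb) bry).
  by case/andP.
Qed.

(** A neighbour [b] of the other marker stands in for the marker of [G], so a copy of [G] survives
    the deletion of [c]. *)
Lemma recomposition_deletion_l b c k : simple_graph C ->
    simple_graph G -> irreflexive G' -> G' None (Some b) -> b != c -> 0 < k ->
    permutationally_representable (induced C [set~ inr c]) k ->
  permutationally_representable G k.
Proof.
move=> Cs [Gs Gi] Gi' Bb bc k0.
pose f (x : option V) : V + V' := if x is Some a then inl a else inr b.
have fc x : f x \in [set~ inr c].
  by rewrite !inE; case: x => //=; apply: contra bc => /eqP[->].
apply: (@representable_preim _ _ (fun x => exist _ (f x) (fc x))) => //.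
- by move=> [x|] [y|] // [->].
- move=> [x|] [y|] //=; rewrite /induced /=; rewrite ?Bb ?andbT //.
  by rewrite Gi Gi'.
- exact: None.
- exact: induced_simple.
Qed.

Lemma recomposition_deletion_r a d k : simple_graph C ->
    simple_graph G' -> irreflexive G -> G None (Some a) -> a != d -> 0 < k ->
    permutationally_representable (induced C [set~ inl d]) k ->
  permutationally_representable G' k.
Proof.
move=> Cs [Gs' Gi'] Gi Aa ad k0.
pose f (x : option V') : V + V' := if x is Some b then inr b else inl a.
have fd x : f x \in [set~ inl d].
  by rewrite !inE; case: x => //=; apply: contra ad => /eqP[->].
apply: (@representable_preim _ _ (fun x => exist _ (f x) (fd x))) => //.
- by move=> [x|] [y|] // [->].
- move=> [x|] [y|] //=; rewrite /induced /=; rewrite ?Aa ?andbT //.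
  by rewrite Gi Gi'.
- exact: None.
- exact: induced_simple.
Qed.

End Recomposition.

(** Irreducibility bounds the dimension of one orientation of the graph without its marker;
    invariance carries the bound over to [s]. *)
Lemma unmarked_realizable (V : finType) (G : rel (option V)) (s : rel V) k n :
    k_prn_irreducible G k -> k.-1 <= n ->
    transitive_orientation (unmarked G) s -> realizable s setT n.
Proof.
move=> irr kn os; have [a0] := marked_vertex_inhabited irr.
have [k2 [[Gs Gi] _] _ /(_ None)[rep _]] := irr.
have k0 : 0 < k.-1 by lia.
have us : simple_graph (unmarked G) by split=> [x y|x]; [apply: Gs | apply: Gi].
have [|t ot tk] := @realizable_of_representable _ _ k.-1 us a0.
  exact: unmarked_representable.
apply: realizable_leq kn _ => //.
exact: realizable_invariant ot os tk.
Qed.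

Theorem theorem12 (V V' : finType)
    (G : rel (option V)) (G' : rel (option V')) (k k' : nat)
    (hk : 3 <= k) (hk' : 3 <= k')
    (Gconn : connected_graph G) (G'conn : connected_graph G')
    (Girr : k_prn_irreducible G k) (G'irr : k_prn_irreducible G' k') :
  ~ prn_irreducible (split_recomposition G G').
Proof.
case=> l [l2 [Cs Co] [_ lmin] del].
have [_ [Gs _] [_ kmin] _] := Girr; have [_ [Gs' _] [_ kmin'] _] := G'irr.
have [d0 nd0] := irreducible_not_universal Girr.
have [c0 nc0] := irreducible_not_universal G'irr.
have [a [d [Aa Ad ad]]] := connected_marked_edge Gconn Gs.1 nd0.
have [b [c [Bb Bc bc]]] := connected_marked_edge G'conn Gs'.1 nc0.
have [s [s' [os os' down up]]] := recomposition_orientation Aa Ad ad Bb Bc bc Co.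
pose n := (maxn k k').-1.
have rs : realizable s setT n by apply: unmarked_realizable Girr _ os; lia.
have rs' : realizable s' setT n by apply: unmarked_realizable G'irr _ os'; lia.
have l0 : 0 < l.-1 by lia.
have kl : k <= l.-1.
  have [rep _] := del (inr c); apply: kmin.
  apply: recomposition_deletion_l rep => //; first exact: Gs'.2; first exact: Bb.
  by apply: contraNneq Bc => <-.
have kl' : k' <= l.-1.
  have [rep _] := del (inl d); apply: kmin'.
  apply: recomposition_deletion_r rep => //; first exact: Gs.2; first exact: Aa.
  by apply: contraNneq Ad => <-.
(* Gluing yields [n.+1 = maxn k k'] permutations, fewer than [l] since [k] and [k'] are at most
   [l.-1]. *)
have /lmin : permutationally_representable (split_recomposition G G') n.+1.
  apply: representable_of_realizable (glue_orientation os os' down up) _ => //.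
  by apply: glue_realizable; rewrite // /n; lia.
by rewrite /n; lia.
Qed.
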